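(* Let $a$ and $b$ be relatively prime positive integers and let $k \ge 0$ be an integer. Let $S_k(a,b)$ be the set of all nonnegative integers $j$ having more than $k$ representations in the form $j = ma + nb$ with $m, n \in \mathbb{Z}_{\ge 0}$. Then, as formal power series in $z$, \[ \sum_{ j \in S_k (a,b) } z^j \ = \ \frac{ z^{ abk } (1 - z^{ ab }) }{ (1-z^a) (1-z^b) } \, . \] Consequently, for $k \ge 1$, letting $R_k(a,b)$ be the set of all nonnegative integers $j$ having exactly $k$ representations $j = ma+nb$ with $m,n \in \mathbb{Z}_{\ge 0}$, we have \[ \sum_{ j \in R_k (a,b) } z^j \ = \ \frac{ z^{ ab(k-1) } (1 - z^{ ab })^2 }{ (1-z^a) (1-z^b) } \, . \]
   Context: The number of representations of a nonnegative integer $j$ is the number of pairs $(m,n) \in \mathbb{Z}_{\ge 0}^2$ with $ma + nb = j$. *)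

(* Defs.v *)
From HB Require Import structures.
From mathcomp Require Import all_boot all_order all_algebra.
From mathcomp Require Import finmap.
From mathcomp Require Import boolp classical_sets functions cardinality fsbigop.
From mathcomp Require Import zify.

Set Implicit Arguments.
Unset Strict Implicit.
Unset Printing Implicit Defensive.

Import GRing.Theory.
Local Open Scope ring_scope.

(* The ring R[[z]] of formal power series. The record wrapper keeps the Cauchy
   product apart from the pointwise ring structure that [nat -> R] carries. *)
Record fps (R : Type) := FPS { fps_coef : nat -> R }.
Arguments FPS {R} _.
Coercion fps_coef : fps >-> Funclass.

HB.instance Definition _ (R : Type) := gen_eqMixin (fps R).
HB.instance Definition _ (R : Type) := gen_choiceMixin (fps R).

Lemma fpsP (R : Type) (f g : fps R) : (forall n, f n = g n) <-> f = g.
Proof.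
split=> [|-> //]; case: f g => [f] [g] /= fg.
by congr FPS; apply/funext.
Qed.

Section FpsZmodule.
Variable R : zmodType.
Implicit Types f g h : fps R.

Definition fps_zero : fps R := FPS (fun=> 0).
Definition fps_opp f : fps R := FPS (fun n => - f n).
Definition fps_add f g : fps R := FPS (fun n => f n + g n).

Lemma fps_addA : associative fps_add.
Proof. by move=> f g h; apply/fpsP => n /=; rewrite addrA. Qed.

Lemma fps_addC : commutative fps_add.
Proof. by move=> f g; apply/fpsP => n /=; rewrite addrC. Qed.

Lemma fps_add0 : left_id fps_zero fps_add.
Proof. by move=> f; apply/fpsP => n /=; rewrite add0r. Qed.

Lemma fps_addN : left_inverse fps_zero fps_opp fps_add.
Proof. by move=> f; apply/fpsP => n /=; rewrite addNr. Qed.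

HB.instance Definition _ :=
  GRing.isZmodule.Build (fps R) fps_addA fps_addC fps_add0 fps_addN.
End FpsZmodule.

Section FpsRing.
Variable R : comNzRingType.
Implicit Types f g h : fps R.

Definition fps_one : fps R := FPS (fun n => (n == 0)%N%:R).
Definition fps_mul f g : fps R :=
  FPS (fun n => \sum_(i < n.+1) f i * g (n - i)%N).

Definition fps_trunc m f : {poly R} := \poly_(i < m) f i.

Lemma coef_fps_trunc m f n : (n < m)%N -> (fps_trunc m f)`_n = f n.
Proof. by move=> nm; rewrite coef_poly nm. Qed.

Lemma coef_fps_mul_trunc m f g n : (n < m)%N ->
  fps_mul f g n = (fps_trunc m f * fps_trunc m g)`_n.
Proof.
move=> nm; rewrite coefM /=; apply: eq_bigr => i _.
by rewrite !coef_fps_trunc //; have := ltn_ord i; lia.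
Qed.

Lemma fps_mulC : commutative fps_mul.
Proof.
by move=> f g; apply/fpsP => n; rewrite !(@coef_fps_mul_trunc n.+1) // mulrC.
Qed.

Lemma fps_mulA : associative fps_mul.
Proof.
move=> f g h; apply/fpsP => n.
transitivity (fps_trunc n.+1 f * (fps_trunc n.+1 g * fps_trunc n.+1 h))`_n.
  rewrite coefM; apply: eq_bigr => i _; rewrite coef_fps_trunc //.
  by rewrite -coef_fps_mul_trunc // ltnS leq_subr.
rewrite mulrA coefM; apply: eq_bigr => i _.
by rewrite coef_fps_trunc ?(@coef_fps_mul_trunc n.+1) // ltnS leq_subr.
Qed.

Lemma fps_mul1 : left_id fps_one fps_mul.
Proof.
move=> f; apply/fpsP => n /=; rewrite big_ord_recl /= mul1r subn0.
by rewrite big1 ?addr0 // => i _; rewrite mul0r.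
Qed.

Lemma fps_mulDl : left_distributive fps_mul +%R.
Proof.
move=> f g h; apply/fpsP => n /=; rewrite -big_split /=.
by apply: eq_bigr => i _; rewrite mulrDl.
Qed.

Lemma fps_one_neq0 : fps_one != 0.
Proof.
by apply/eqP => /fpsP/(_ 0%N)/= /eqP; rewrite oner_eq0.
Qed.

HB.instance Definition _ := GRing.Zmodule_isComNzRing.Build (fps R)
  fps_mulA fps_mulC fps_mul1 fps_mulDl fps_one_neq0.

Definition fpsX : fps R := FPS (fun n => (n == 1)%N%:R).

(* The sum of a family of power series, computed coefficient by coefficient; it
   is meaningful when each coefficient of [F i] vanishes for all but finitely
   many [i] in [A], as is the case for the family of monomials z^i. *)
Definition fps_sum (I : choiceType) (A : set I) (F : I -> fps R) : fps R :=
  FPS (fun n => \sum_(i \in A) F i n).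

Lemma coef_fpsXn m n : (fpsX ^+ m) n = (n == m)%N%:R.
Proof.
elim: m n => [|m IH] n; first by rewrite expr0.
rewrite exprS; case: n => [|n].
  by rewrite /= big_ord_recl big_ord0 /= mul0r addr0.
rewrite /= big_ord_recl big_ord_recl /= mul0r add0r mul1r subn1 IH /= eqSS.
by rewrite big1 ?addr0 // => i _; rewrite mul0r.
Qed.

Lemma coef_fps_sumXn (A : set nat) n :
  (fps_sum A (fun j => fpsX ^+ j)) n = (n \in A)%:R.
Proof.
rewrite /= (eq_fsbigr (fun j => (n == j)%N%:R)) => [|j _]; last exact: coef_fpsXn.
case: (boolP (n \in A)) => [/set_mem nA|/negP nA]; last first.
  rewrite fsbig1 // => j Aj; case: eqP => // nj.
  by case: nA; rewrite nj; exact: mem_set.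
rewrite -(fsbig_widen [set n]%classic A) ?fsbig_set1 ?eqxx // => [j -> //|].
by move=> j [_ /= /eqP]; rewrite eq_sym => /negPf ->.
Qed.
End FpsRing.

Arguments fpsX {R}.

Section FpsUnit.
Variable R : comUnitRingType.
Implicit Types f g : fps R.

Definition fps_unit : pred (fps R) := fun f => f 0%N \is a GRing.unit.

(* [fps_inv_seq f n] lists the first n coefficients of the inverse g of f, read
   off from f_0 g_0 = 1 and sum_(i <= n) f_(n-i) g_i = 0 for n > 0. *)
Fixpoint fps_inv_seq f (n : nat) : seq R :=
  if n is m.+1 then
    let s := fps_inv_seq f m in
    rcons s ((f 0%N)^-1 * ((m == 0)%N%:R - \sum_(i < m) f (m - i)%N * s`_i))
  else [::].

Definition fps_inv f : fps R :=
  if fps_unit f then FPS (fun n => (fps_inv_seq f n.+1)`_n) else f.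

Lemma size_fps_inv_seq f n : size (fps_inv_seq f n) = n.
Proof. by elim: n => //= n IH; rewrite size_rcons IH. Qed.

Lemma nth_fps_inv_seq f n i : (i < n)%N ->
  (fps_inv_seq f n)`_i = (fps_inv_seq f i.+1)`_i.
Proof.
elim: n => // n IH; rewrite ltnS leq_eqVlt => /orP[/eqP-> //|ltin].
by rewrite [LHS]/= nth_rcons size_fps_inv_seq ltin IH.
Qed.

Lemma fps_mulVx : {in fps_unit, left_inverse 1 fps_inv *%R}.
Proof.
move=> f Uf; have Uf0 : f 0%N \is a GRing.unit by [].
apply/fpsP => n; rewrite /fps_inv ifT // [LHS]/= big_ord_recr /= subnn.
rewrite nth_rcons size_fps_inv_seq ltnn eqxx mulrAC mulVr // mul1r.
under eq_bigr => i _.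
  rewrite -[rcons _ _]/(fps_inv_seq f i.+1) -(@nth_fps_inv_seq f n) // mulrC.
  over.
by rewrite addrC subrK.
Qed.

Lemma fps_unitPl f g : g * f = 1 -> fps_unit f.
Proof.
move=> /fpsP/(_ 0%N); rewrite /= big_ord_recl big_ord0 addr0 /= => gf1.
by rewrite /fps_unit; apply/unitrPr; exists (g 0%N); rewrite mulrC.
Qed.

Lemma fps_inv_out : {in [predC fps_unit], fps_inv =1 id}.
Proof. by move=> f Uf; rewrite /fps_inv ifN. Qed.

HB.instance Definition _ := GRing.ComNzRing_hasMulInverse.Build (fps R)
  fps_mulVx fps_unitPl fps_inv_out.

Lemma fps_unitE f : (f \is a GRing.unit) = (f 0%N \is a GRing.unit).
Proof. by []. Qed.

Lemma subr1X_unit n : (0 < n)%N -> (1 - fpsX ^+ n : fps R) \is a GRing.unit.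
Proof.
by case: n => // n _; rewrite fps_unitE /= -/(fps_coef _ _) coef_fpsXn subr0 unitr1.
Qed.
End FpsUnit.

Local Open Scope classical_set_scope.

Definition representations (a b j : nat) : set (nat * nat) :=
  [set p | (p.1 * a + p.2 * b = j)%N].

(* [fset_set] is only meaningful on finite sets; see finite_representations. *)
Definition num_representations (a b j : nat) : nat :=
  #|` fset_set (representations a b j)|.

Lemma finite_representations (a b j : nat) :
  (0 < a)%N -> (0 < b)%N -> finite_set (representations a b j).
Proof.
move=> a0 b0; apply: (@sub_finite_set _ _ (`I_j.+1 `*` `I_j.+1)).
  move=> [m n] /= <-; split; rewrite /= ltnS.
    by rewrite (leq_trans (leq_pmulr m a0)) // leq_addr.
  by rewrite (leq_trans (leq_pmulr n b0)) // leq_addl.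
exact: finite_setX.
Qed.

Definition S_ (k a b : nat) : set nat :=
  [set j | (k < num_representations a b j)%N].

Definition R_ (k a b : nat) : set nat :=
  [set j | num_representations a b j = k].

(* Main.v *)
Require Import Defs.
From mathcomp Require Import all_boot all_order all_algebra.
From mathcomp Require Import finmap boolp classical_sets functions cardinality.
From mathcomp Require Import zify ring.

(* Modulo the exchange (m, n) |-> (m - b, n + a), each representation of j comes
   from one with n < a, and that one is unique because a and b are coprime.
   Hence j has more than k representations iff j = m a + n b + a b k for some m
   and some n < a, so multiplying the series of S_k by 1 - z^a leaves
   z^(a b k) (1 + z^b + ... + z^((a - 1) b)), a finite geometric sum. *)

Import GRing.Theory.

Section Representations.
Variables a b : nat.
Hypotheses (a_gt0 : 0 < a) (b_gt0 : 0 < b) (coprime_ab : coprime a b).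

Lemma eqn_mod_mul2r m n : (m * b == n * b %[mod a]) = (m == n %[mod a]).
Proof.
wlog le_mn : m n / m <= n.
  move=> H; case: (leqP m n) => [/H //|/ltnW /H].
  by rewrite eq_sym => ->; rewrite eq_sym.
by rewrite eq_sym [RHS]eq_sym !eqn_mod_dvd ?leq_mul // -mulnBl Gauss_dvdl.
Qed.

(** Modulo [a] the equation reads [n' * b = n * b]. Cancelling the coprime [b] and using [n < a]
    makes [n] the remainder of [n'] by [a], and [t] is the quotient. *)
Lemma representation_shift m n m' n' : n < a ->
  m' * a + n' * b = m * a + n * b ->
  exists2 t, n' = n + a * t & m = m' + b * t.
Proof.
move=> n_lt_a eq_j.
have n'E : n' %% a = n.
  rewrite -[RHS](modn_small n_lt_a); apply/eqP; rewrite -eqn_mod_mul2r.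
  by rewrite -(modnMDl m' (n' * b)) eq_j modnMDl.
exists (n' %/ a); first by rewrite {1}(divn_eq n' a) n'E addnC mulnC.
apply/eqP; rewrite -(eqn_pmul2r a_gt0) -(eqn_add2r (n * b)) -eq_j.
by rewrite {1}(divn_eq n' a) n'E; apply/eqP; ring.
Qed.

(** The representations are the pairs [(m - b * t, n + a * t)]; the bound [t <= m %/ b] is exactly
    what keeps the natural-number subtraction from truncating. *)
Lemma num_representationsE m n : n < a ->
  num_representations a b (m * a + n * b) = (m %/ b).+1.
Proof.
move=> n_lt_a; apply: card_fset_set.
have -> : representations a b (m * a + n * b) =
    [set (m - b * t, n + a * t) | t in `I_(m %/ b).+1]%classic.
  apply/seteqP; split=> [[m' n'] jE|].
    have [t -> ->] := representation_shift _ _ m' n' n_lt_a jE.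
    exists t; last by rewrite addnK.
    by rewrite /= ltnS leq_divRL // mulnC leq_addl.
  move=> _ [t /= + <-]; rewrite ltnS leq_divRL // /representations /= => le_t.
  by rewrite -{2}(subnK le_t) [t * b]mulnC; ring.
apply: inj_card_eq => t u _ _ [_ /eqP].
by rewrite eqn_add2l eqn_pmul2l // => /eqP.
Qed.

(** For [n < a] the count [(m %/ b).+1] exceeds [k] iff [k * b <= m], so [k * b] can be split off
    from the coefficient of [a]. *)
Lemma mem_S k j :
  S_ k a b j <-> exists m n, n < a /\ j = m * a + n * b + a * b * k.
Proof.
split=> [|[m [n [n_lt_a ->]]]]; last first.
  rewrite /S_ /=.
  have -> : m * a + n * b + a * b * k = (m + k * b) * a + n * b by ring.
  by rewrite num_representationsE // ltnS divnDMl // leq_addl.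
rewrite /S_ /= => lt_k.
have /set0P[[m0 n0] /= rep_j] : representations a b j != set0%classic.
  by apply: contraTneq lt_k => rep0; rewrite /num_representations rep0 fset_set0.
(* Normalise an arbitrary representation: the multiples of [a] in [n0] are traded for multiples of
   [b] in the coefficient of [a]. *)
have lt_n : n0 %% a < a by rewrite ltn_mod.
have jE : j = (m0 + n0 %/ a * b) * a + n0 %% a * b.
  by rewrite -rep_j /= {1}(divn_eq n0 a); ring.
move: lt_k; rewrite jE num_representationsE // ltnS leq_divRL // => le_kb.
exists (m0 + n0 %/ a * b - k * b), (n0 %% a); split=> //.
by rewrite -{1}(subnK le_kb); ring.
Qed.
End Representations.

Local Open Scope ring_scope.

Section Series.
Variable K : comUnitRingType.
Implicit Types f g : fps K.

Lemma coef_fpsXnM m f n :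
  (fpsX ^+ m * f) n = if (m <= n)%N then f (n - m)%N else 0.
Proof.
rewrite /= (eq_bigr (fun i : 'I_n.+1 => if i == m :> nat then f (n - m)%N else 0)).
  rewrite -big_mkcond /=; case: leqP => [le_mn|lt_nm].
    by rewrite (big_pred1 (Ordinal (le_mn : (m < n.+1)%N))).
  by rewrite big_pred0 // => i; have := ltn_ord i; lia.
move=> i _; have /= -> := coef_fpsXn K m i.
by case: eqP => [->|_]; rewrite ?mul1r ?mul0r.
Qed.

Lemma coef_fpsB f g n : (f - g) n = f n - g n.
Proof. by []. Qed.

Lemma coef_fps_sum (I : finType) (F : I -> fps K) n :
  (\sum_i F i) n = \sum_i F i n.
Proof. exact: (big_morph (fun f : fps K => f n)). Qed.

Section Coprime.
Variables a b : nat.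
Hypotheses (a_gt0 : (0 < a)%N) (b_gt0 : (0 < b)%N) (coprime_ab : coprime a b).

(** By [mem_S] the set is stable under adding [a], so the factor [1 - z^a] cancels every element
    except those with [m = 0]. *)
Lemma S_series_mul k :
  (1 - fpsX ^+ a) * fps_sum (S_ k a b) (fun j => fpsX ^+ j) =
  \sum_(i < a) fpsX ^+ (i * b + a * b * k) :> fps K.
Proof.
apply/fpsP => n; rewrite mulrBl mul1r coef_fpsB coef_fps_sum.
under eq_bigr do rewrite coef_fpsXn.
rewrite coef_fpsXnM !coef_fps_sumXn.
have [[i0 nE]|no_i] := pselect (exists i : 'I_a, n = i * b + a * b * k)%N.
  rewrite (bigD1 i0) //= -nE eqxx big1 => [|i i_neq]; last first.
    by rewrite nE eqn_add2r eqn_pmul2r // eq_sym -[_ == _]/(i == i0) (negPf i_neq).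
  rewrite (_ : n \in _ = true); last first.
    by apply/mem_set/mem_S => //; exists 0%N, i0; split.
  case: leqP => [le_an|_]; last by rewrite subr0 addr0.
  (* If [n - a] were in the set, [n - a * b * k] would have a representation with [m.+1] copies of
     [a] beside the one with none, and the shift would give [0 = m.+1 + b * t]. *)
  case: (boolP (_ \in _)) => [/set_mem/mem_S[]//|_]; last by rewrite subr0 addr0.
  move=> m [i [_ naE]].
  have [] // := @representation_shift a b a_gt0 coprime_ab 0 i0 m.+1 i.
    by apply/(@addIn (a * b * k)); rewrite mul0n add0n -nE -(subnK le_an) naE; ring.
(* At any other exponent, [n] is in the set iff [a <= n] and [n - a] is, so the two coefficients
   agree. *)
rewrite big1 => [|i _]; last by case: eqP => // nE; case: no_i; exists i.
apply/eqP; rewrite subr_eq0; apply/eqP.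
case: (boolP (n \in _)) => [/set_mem/mem_S[]//|n_notin].
  move=> [|m] [i [lt_i nE]]; first by case: no_i; exists (Ordinal lt_i).
  have nE' : (n = m * a + i * b + a * b * k + a)%N by rewrite nE; ring.
  rewrite nE' leq_addl addnK mem_set //.
  by apply/mem_S => //; exists m, i; split.
case: leqP => // le_an; case: (boolP (_ \in _)) => // /set_mem/mem_S[]//.
move=> m [i [lt_i naE]]; case/negP: n_notin; apply/mem_set/mem_S => //.
by exists m.+1, i; split=> //; rewrite -(subnK le_an) naE; ring.
Qed.

Lemma S_series k :
  fps_sum (S_ k a b) (fun j => fpsX ^+ j) =
    fpsX ^+ (a * b * k) * (1 - fpsX ^+ (a * b))
      / ((1 - fpsX ^+ a) * (1 - fpsX ^+ b)) :> fps K.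
Proof.
apply: (canRL (mulrK _)); first by rewrite unitrM !subr1X_unit.
rewrite mulrA [fps_sum _ _ * _]mulrC S_series_mul.
under eq_bigr do rewrite exprD mulnC exprM.
rewrite -mulr_suml mulrAC mulrC; congr (_ * _).
(* Geometric sum in [z^b] with [a] terms; [subrX1] concerns [x ^+ n - 1], hence the change of
   sign. *)
by apply: oppr_inj; rewrite -mulrN !opprB mulrC -subrX1 -exprM mulnC.
Qed.

(** [S_ k.+1 a b] is contained in [S_ k a b], and what it leaves out has count exactly [k.+1]. *)
Lemma R_series k :
  fps_sum (R_ k.+1 a b) (fun j => fpsX ^+ j) =
    fps_sum (S_ k a b) (fun j => fpsX ^+ j)
      - fps_sum (S_ k.+1 a b) (fun j => fpsX ^+ j) :> fps K.
Proof.
apply/fpsP => n; rewrite coef_fpsB !coef_fps_sumXn.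
have memE (A : set nat) (p : bool) : (A n <-> p) -> (n \in A) = p.
  by move=> Ap; apply/idP/idP => [/set_mem/Ap|/Ap/mem_set].
rewrite (memE _ (num_representations a b n == k.+1)); last by split=> /eqP.
rewrite (memE _ (k < num_representations a b n)%N) //.
rewrite (memE _ (k.+1 < num_representations a b n)%N) //.
by rewrite [(k < _)%N]leq_eqVlt; case: ltngtP; rewrite ?subr0 ?subrr.
Qed.
End Coprime.
End Series.

Theorem theorem2 (K : comUnitRingType) (a b k : nat)
    (ha : (0 < a)%N) (hb : (0 < b)%N) (hab : coprime a b) :
  let z : fps K := fpsX in
  fps_sum (S_ k a b) (fun j => z ^+ j) =
    z ^+ (a * b * k) * (1 - z ^+ (a * b)) / ((1 - z ^+ a) * (1 - z ^+ b))
  /\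
  ((1 <= k)%N ->
   fps_sum (R_ k a b) (fun j => z ^+ j) =
     z ^+ (a * b * (k - 1)) * (1 - z ^+ (a * b)) ^+ 2
       / ((1 - z ^+ a) * (1 - z ^+ b))).
Proof.
move=> z; split; first exact: S_series.
case: k => // k _; rewrite R_series !S_series // subn1 /=.
(* Both numerators share [z^(a b k) (1 - z^(a b))]; their difference contributes the second factor
   [1 - z^(a b)]. *)
by rewrite -mulrBl -mulrBl mulnS exprD; congr (_ / _); ring.
Qed.
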